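(* Let $H\in(0,1)$ and let $u(t)=\sum_{k\ge1}u_k(t)h_k$ be the solution of the diagonalizable equation $du(t)=(\mathcal{A}_0+\theta\mathcal{A}_1)u(t)\,dt+\mathcal{M}u(t)\,dW^H(t)$. Let $k,m\in\mathbb{N}$ be such that $u_k(0)\ne0$, $u_m(0)\neq0$ and $\nu_k\mu_m\ne\nu_m\mu_k$, and write $v_j(t)=\ln(u_j(t)/u_j(0))$. Then, for every $t>0$, the parameter $\theta$ is given exactly by $$\theta=\frac{\mu_mv_k(t)-\mu_kv_m(t)+(\rho_m\mu_k-\rho_k\mu_m)t+\frac12(\mu_k^2\mu_m-\mu_m^2\mu_k)t^{2H}}{t(\nu_k\mu_m-\nu_m\mu_k)} .$$
   Context: $W^H$ is a fractional Brownian motion with Hurst parameter $H$: a zero-mean Gaussian process with $\mathbb{E}W^H(t)W^H(s)=\frac12(t^{2H}+s^{2H}-|t-s|^{2H})$. $\mathcal{A}_0,\mathcal{A}_1,\mathcal{M}$ are linear operators in a separable Hilbert space and $\theta$ is a real parameter. The equation is diagonalizable if these operators have point spectrum and a common system of eigenfunctions $\{h_k\}_{k\ge1}$ (a complete orthonormal system); write $\mathcal{A}_0h_k=\rho_kh_k$, $\mathcal{A}_1h_k=\nu_kh_k$, $\mathcal{M}h_k=\mu_kh_k$. By definition, the solution is $u(t)=\sum_{k\ge1}u_k(t)h_k$ with $$u_k(t)=u_k(0)\exp\left((\rho_k+\theta\nu_k)t-\tfrac12\mu_k^2t^{2H}+\mu_kW^H(t)\right),$$ where the $u_k(0)$ are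 the Fourier coefficients of the deterministic initial condition. *)

(* Defs.v *)
From HB Require Import structures.
From mathcomp Require Import all_boot all_order all_algebra.
From mathcomp Require Import sesquilinear.
From mathcomp Require Import all_classical all_reals all_analysis.
From mathcomp Require Import ring.

Set Implicit Arguments.
Unset Strict Implicit.
Unset Printing Implicit Defensive.

Import Order.TTheory GRing.Theory Num.Theory.
Import numFieldNormedType.Exports.
Local Open Scope classical_set_scope.
Local Open Scope ring_scope.

Section fractional_brownian_motion.
Context (d : measure_display) (T : measurableType d) (R : realType)
  (P : probability T R).

(* The degenerate case needs [dirac]: [normal_prob m 0] is the uniform
   distribution on [0, 1]. *)
Definition gaussian (X : T -> R) : Prop :=
  exists m s : R, 0 <= s /\ forall A : set R, measurable A ->
    pushforward P X A = if s == 0 then \d_m A else normal_prob m s A.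

(* [W] is indexed by [R]; only its values at nonnegative times are
   constrained. *)
Record fBm (H : R) (W : R -> {RV P >-> R}) : Prop := {
  fBm_gaussian : forall (n : nat) (t a : 'I_n -> R),
    (forall i, 0 <= t i) -> gaussian (fun w => \sum_(i < n) a i * W (t i) w) ;
  fBm_mean : forall t, 0 <= t -> ('E_P[W t] = 0)%E ;
  fBm_cov : forall t s, 0 <= t -> 0 <= s ->
    ('E_P[fun w => (W t w * W s w)%R] =
     (2^-1 * (t `^ (2 * H) + s `^ (2 * H) - `|t - s| `^ (2 * H)))%:E)%E }.

End fractional_brownian_motion.

Section hilbert_space.
Context (R : realType) (V : completeNormedModType R).

(* With completeness of [V], this makes [V] a real Hilbert space. *)
Definition induces_norm (ip : {dot V for idfun}) : Prop :=
  forall x, ip x x = `|x| ^+ 2.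

Definition separable_space : Prop := exists2 S : set V, countable S & dense S.

(* A linear operator in [V], not necessarily bounded nor everywhere defined;
   the values of [op] outside [op_dom] are irrelevant. *)
Record linear_operator := LinearOperator {
  op_dom : set V ;
  op :> V -> V ;
  op_dom0 : op_dom 0 ;
  op_domP : forall (a : R) x y, op_dom x -> op_dom y -> op_dom (a *: x + y) ;
  op_linear : forall (a : R) x y, op_dom x -> op_dom y ->
    op (a *: x + y) = a *: op x + op y }.

Definition eigenpair (A : linear_operator) (l : R) (x : V) : Prop :=
  [/\ x != 0, op_dom A x & A x = l *: x].

Definition lin_span (h : nat -> V) : set V :=
  [set x | exists (n : nat) (a : 'I_n -> R), x = \sum_(i < n) a i *: h i].

Definition complete_orthonormal (ip : {dot V for idfun}) (h : nat -> V) : Prop :=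
  (forall i j, ip (h i) (h j) = (i == j)%:R) /\ dense (lin_span h).

(* The eigenvalues and eigenfunctions are indexed from 0. *)
Record diagonalizable_equation (ip : {dot V for idfun}) (A0 A1 M : linear_operator)
    (h : nat -> V) (rho nu mu : nat -> R) : Prop := {
  diag_basis : complete_orthonormal ip h ;
  diag_A0 : forall k, eigenpair A0 (rho k) (h k) ;
  diag_A1 : forall k, eigenpair A1 (nu k) (h k) ;
  diag_M : forall k, eigenpair M (mu k) (h k) }.

(* [f] is the sum of the series of the [c k *: h k] as a generalized vector:
   a functional, acting on the linear span of the [h k], where a vector [x] of
   [V] acts as [ip x].  Every sequence of coefficients has such a sum, which is
   unique on the span, so nothing is assumed about convergence of the series
   in [V]; if the series does converge in [V], the generalized sum is its usual
   sum, see [gen_sum_of_cvg]. *)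
Definition gen_sum (ip : {dot V for idfun}) (h : nat -> V) (c : nat -> R)
    (f : V -> R) : Prop :=
  forall x, lin_span h x -> series (fun k => c k * ip (h k) x) @ \oo --> f x.

Definition fourier_coef (h : nat -> V) (f : V -> R) (k : nat) : R := f (h k).

Lemma cauchy_schwarz (ip : {dot V for idfun}) (hip : induces_norm ip) x y :
  `|ip x y| <= `|x| * `|y|.
Proof.
have [->|y0] := eqVneq y 0; first by rewrite linear0r !normr0 mulr0.
have yy : 0 < `|y| ^+ 2 by rewrite exprn_gt0 // normr_gt0.
have sym u v : ip u v = ip v u.
  by have := @hermitian_subproof R V false idfun ip u v; rewrite expr0 mul1r.
rewrite -(@ler_pXn2r _ 2) ?nnegrE ?mulr_ge0 // -normrX ger0_norm ?sqr_ge0 //.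
set b := `|y| ^+ 2 in yy *; set a := ip x y.
have : 0 <= ip (b *: x - a *: y) (b *: x - a *: y) by rewrite hip sqr_ge0.
rewrite linearBl !linearBr !linearZl !linearZr /= (sym y x) -/a !hip -/b => hge.
have {hge} : 0 <= b * (b * `|x| ^+ 2 - a ^+ 2).
  by apply: (le_trans hge); rewrite le_eqVlt; apply/orP; left; apply/eqP; ring.
by rewrite (pmulr_rge0 _ yy) subr_ge0 exprMn mulrC.
Qed.

Lemma gen_sum_of_cvg (ip : {dot V for idfun}) (hip : induces_norm ip)
    (h : nat -> V) (c : nat -> R) (x : V) :
  series (fun k => c k *: h k) @ \oo --> x -> gen_sum ip h c (ip x).
Proof.
move=> cx y _.
have -> : series (fun k => c k * ip (h k) y) =
          (fun n => ip (series (fun k => c k *: h k) n) y).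
  apply/funext => n; rewrite /series /= linear_sumlz.
  by apply: eq_bigr => k _; rewrite linearZl.
apply/cvgrPdist_le => e e0.
have y1 : 0 < `|y| + 1 by rewrite ltr_wpDl.
have /cvgrPdist_le/(_ (e / (`|y| + 1)) (divr_gt0 e0 y1)) := cx.
apply: filterS => n hn.
rewrite -linearBl; apply: (le_trans (cauchy_schwarz hip _ _)).
rewrite -(@divfK _ (`|y| + 1) _ e) ?gt_eqF //.
by rewrite ler_pM // lerDl.
Qed.

End hilbert_space.

Section solution.
Context (d : measure_display) (T : measurableType d) (R : realType)
  (P : probability T R) (V : completeNormedModType R).

Definition sol_coef (H theta : R) (W : R -> {RV P >-> R})
    (rho nu mu : nat -> R) (c0 : nat -> R) (k : nat) (t : R) (w : T) : R :=
  c0 k * expR ((rho k + theta * nu k) * t - 2^-1 * mu k ^+ 2 * t `^ (2 * H)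
               + mu k * W t w).

(* The solution of du = (A0 + theta A1) u dt + M u dW with initial condition
   [u0] is by definition the sum of the explicit series.  The identity holds on
   every path; as [W 0 w = 0] is only almost sure, the coefficients of [u 0 w]
   agree with those of [u0] for almost every [w] only. *)
Definition solution (ip : {dot V for idfun}) (h : nat -> V) (H theta : R)
    (W : R -> {RV P >-> R}) (rho nu mu : nat -> R) (u0 : V)
    (u : R -> T -> V -> R) : Prop :=
  forall (t : R) (w : T), 0 <= t ->
    gen_sum ip h
      (fun k => sol_coef H theta W rho nu mu (fourier_coef h (ip u0)) k t w)
      (u t w).

End solution.

(* Main.v *)
Require Import Defs.
From HB Require Import structures.
From mathcomp Require Import all_boot all_order all_algebra.
From mathcomp Require Import sesquilinear.
From mathcomp Require Import all_classical all_reals all_analysis.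
From mathcomp Require Import ring.
Import Order.TTheory GRing.Theory Num.Theory.
Import numFieldNormedType.Exports.
Local Open Scope classical_set_scope.
Local Open Scope ring_scope.

(** Pairing the generalized sum with a basis vector recovers its coefficient
    ([gen_sum_fourier_coef]), because the basis is orthonormal and so the series
    paired with [h j] has a single nonzero term.  Hence the logarithm of the
    [j]-th Fourier coefficient of the solution, relative to its initial value,
    is affine in the single random number [W t w], with slope [mu j]
    ([ln_sol_coef]).  Two modes [k] and [m] are driven by the same noise, so the
    combination [mu m * v k - mu k * v m] cancels it exactly, on every path.
    What remains is an affine equation for [theta] with leading coefficient
    [t * (nu k * mu m - nu m * mu k)], nonzero by assumption. *)

Lemma gen_sum_fourier_coef (R : realType) (V : completeNormedModType R)
    (ip : {dot V for idfun}) (h : nat -> V) (c : nat -> R) (f : V -> R) :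
  (forall i j, ip (h i) (h j) = (i == j)%:R) -> gen_sum ip h c f ->
  forall j, fourier_coef h f j = c j.
Proof.
move=> h_on f_sum j.
have span_hj : lin_span h (h j).
  exists j.+1, (fun i => (i == ord_max)%:R).
  rewrite (bigD1 ord_max) //= eqxx scale1r big1 ?addr0 // => i /negPf ->.
  by rewrite scale0r.
apply/esym; apply: (cvg_unique _ _ (f_sum _ span_hj)) => //.
apply: cvg_near_cst; exists j.+1 => // n /= jn.
rewrite /series /= (bigD1_seq j) ?mem_index_iota ?iota_uniq //= h_on eqxx mulr1.
by rewrite big1 ?addr0 // => i /negPf ij; rewrite h_on ij mulr0.
Qed.

Lemma ln_sol_coef (R : realType) (d : measure_display) (T : measurableType d)
    (P : probability T R) (H theta : R) (W : R -> {RV P >-> R})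
    (rho nu mu c0 : nat -> R) (k : nat) (t : R) (w : T) :
  c0 k != 0 ->
  ln (sol_coef H theta W rho nu mu c0 k t w / c0 k) =
  (rho k + theta * nu k) * t - 2^-1 * mu k ^+ 2 * t `^ (2 * H) + mu k * W t w.
Proof. by move=> c0k; rewrite /sol_coef mulrAC divff // mul1r expRK. Qed.

Theorem mainTheorem4 (R : realType)
  (d : measure_display) (T : measurableType d) (P : probability T R)
  (V : completeNormedModType R) (ip : {dot V for idfun})
  (ip_norm : induces_norm ip) (V_separable : separable_space V)
  (H : R) (H_gt0 : 0 < H) (H_lt1 : H < 1)
  (W : R -> {RV P >-> R}) (W_fBm : fBm H W)
  (A0 A1 M : linear_operator V) (h : nat -> V) (rho nu mu : nat -> R)
  (A_diag : diagonalizable_equation ip A0 A1 M h rho nu mu)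
  (theta : R) (u0 : V) (u : R -> T -> V -> R)
  (u_sol : solution ip h H theta W rho nu mu u0 u)
  (k m : nat)
  (u0k : fourier_coef h (ip u0) k != 0)
  (u0m : fourier_coef h (ip u0) m != 0)
  (hkm : nu k * mu m != nu m * mu k)
  (t : R) (t_gt0 : 0 < t) (w : T) :
  let v := fun j =>
    ln (fourier_coef h (u t w) j / fourier_coef h (ip u0) j) in
  theta =
    (mu m * v k - mu k * v m + (rho m * mu k - rho k * mu m) * t
     + 2^-1 * (mu k ^+ 2 * mu m - mu m ^+ 2 * mu k) * t `^ (2 * H))
    / (t * (nu k * mu m - nu m * mu k)).
Proof.
move=> v.
have vE j : fourier_coef h (ip u0) j != 0 -> v j =
    (rho j + theta * nu j) * t - 2^-1 * mu j ^+ 2 * t `^ (2 * H) + mu j * W t w.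
  move=> u0j; have [h_on _] := diag_basis A_diag.
  rewrite /v (gen_sum_fourier_coef _ _ _ _ _ _ h_on (u_sol t w (ltW t_gt0))).
  exact: ln_sol_coef.
have D0 : t * (nu k * mu m - nu m * mu k) != 0.
  by rewrite mulf_neq0 ?(gt_eqF t_gt0) // subr_eq0.
apply: (canRL (mulfK D0)); rewrite (vE k u0k) (vE m u0m).
ring.
Qed.
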